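(* Let $E$ be a Hilbert $C^*$-module over a $C^*$-algebra $\mathcal{A}$. Then $$\mathrm{lat}\,\mathcal{L}(E) = \{ E(\mathcal{J}) \mid \mathcal{J} \subseteq \overline{\langle E,E\rangle} \text{ a closed left ideal} \},$$ and the association $\mathcal{J} \mapsto E(\mathcal{J})$ establishes a complete lattice isomorphism between the lattice of closed left ideals of $\overline{\langle E,E\rangle}$ and $\mathrm{lat}\,\mathcal{L}(E)$. In addition, $$\mathrm{lat}\,\mathcal{K}(E) = \mathrm{lat}\,\mathcal{L}(E) = \mathrm{lat}\,\mathrm{End}_{\mathcal{A}}(E).$$
   Context: $\mathcal{A}$ is a (complex, not necessarily unital) $C^*$-algebra. A Hilbert $C^*$-module $E$ over $\mathcal{A}$ is a right $\mathcal{A}$-module equipped with an $\mathcal{A}$-valued inner product $\langle\cdot,\cdot\rangle$ (linear in the second variable, conjugate linear in the first, with $\langle x, ya\rangle = \langle x,y\rangle a$ and $\langle x,y\rangle^* = \langle y,x\rangle$) such that the norm $\|\xi\| = \|\langle \xi,\xi\rangle^{1/2}\|$ makes $E$ into a Banach space. $\overline{\langle E,E\rangle}$ denotes the norm-closed linear span in $\mathcal{A}$ of $\{\langle \eta,\xi\rangle \mid \eta,\xi\in E\}$ (a closed two-sided ideal of $\mathcal{A}$). $\mathrm{End}_{\mathcal{A}}(E)$ is the algebra of all bounded $\mathcal{A}$-module operators on $E$, i.e. bounded linear $S:E\to E$ with $S(xa)=S(x)a$ for all $x\in E$, $a\in\mathcal{A}$. A linear operator $S$ on $E$ is adjointable if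 for every $y\in E$ there is $y'\in E$ with $\langle Sx,y\rangle=\langle x,y'\rangle$ for all $x\in E$; $\mathcal{L}(E)$ is the algebra of all adjointable operators on $E$ (it is well known that $\mathcal{L}(E)\subseteq \mathrm{End}_{\mathcal{A}}(E)$). For $\eta,\xi\in E$, $\theta_{\eta,\xi}$ is the operator $\theta_{\eta,\xi}(x)=\eta\langle\xi,x\rangle$, and $\mathcal{K}(E)$ is the norm-closed subalgebra generated by all the operators $\theta_{\eta,\xi}$. For an algebra $\mathfrak{A}$ of bounded operators on a Banach space $\mathfrak{X}$, $\mathrm{lat}\,\mathfrak{A}$ is the collection of all closed subspaces $M\subseteq\mathfrak{X}$ with $A(m)\in M$ for all $A\in\mathfrak{A}$, $m\in M$; it is a complete lattice under inclusion, with meet given by intersection and join by closed linear span. Closed left ideals likewise form a complete lattice, with meet given by intersection and join by closed linear span. For $\mathcal{J}\subseteq\mathcal{A}$, $E(\mathcal{J}) := \overline{\mathrm{span}}\{\xi a \mid \xi \in E,\ a \in \mathcal{J}\}$. *)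

(* Defs.v *)
From HB Require Import structures.
From mathcomp Require Import all_boot all_order all_algebra.
From mathcomp Require Import all_classical all_reals all_analysis.
From mathcomp Require Export complex.

Set Implicit Arguments.
Unset Strict Implicit.
Unset Printing Implicit Defensive.

Import Order.TTheory GRing.Theory Num.Theory.
Import numFieldNormedType.Exports.
Local Open Scope classical_set_scope.
Local Open Scope ring_scope.

(* MathComp rings are unital, so the product of a possibly non-unital
   C*-algebra is a separate operation [cmul] on a complex Banach space. *)
HB.mixin Record isCStarAlgebra (R : realType) A
    of CompleteNormedModule R[i] A := {
  cmul : A -> A -> A ;
  cstar : A -> A ;
  cmulA : forall a b c : A, cmul a (cmul b c) = cmul (cmul a b) c ;
  cmulDl : forall a b c : A, cmul (a + b) c = cmul a c + cmul b c ;
  cmulDr : forall a b c : A, cmul a (b + c) = cmul a b + cmul a c ;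
  cmulZl : forall (z : R[i]) (a b : A), cmul (z *: a) b = z *: cmul a b ;
  cmulZr : forall (z : R[i]) (a b : A), cmul a (z *: b) = z *: cmul a b ;
  cstarK : forall a : A, cstar (cstar a) = a ;
  cstarD : forall a b : A, cstar (a + b) = cstar a + cstar b ;
  cstarZ : forall (z : R[i]) (a : A), cstar (z *: a) = z^* *: cstar a ;
  cstarM : forall a b : A, cstar (cmul a b) = cmul (cstar b) (cstar a) ;
  cnormM : forall a b : A, `|cmul a b| <= `|a| * `|b| ;
  cnorm_star : forall a : A, `|cmul (cstar a) a| = `|a| ^+ 2 }.

#[short(type="cstarAlgType")]
HB.structure Definition CStarAlgebra (R : realType) :=
  {A of isCStarAlgebra R A & CompleteNormedModule R[i] A}.

Definition cpos (R : realType) (A : cstarAlgType R) : set A :=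
  [set a | exists b : A, a = cmul (cstar b) b].

(* The positive square root; only meaningful when [a] is positive, in which
   case it exists and is unique. *)
Definition csqrt (R : realType) (A : cstarAlgType R) (a : A) : A :=
  xget 0 [set b | cpos b /\ cmul b b = a].

(* Definiteness of [inner] is a consequence of [hnormE]. *)
HB.mixin Record isHilbertModule (R : realType) (A : cstarAlgType R) E
    of CompleteNormedModule R[i] E := {
  ract : E -> A -> E ;
  inner : E -> E -> A ;
  ractDl : forall (x y : E) (a : A), ract (x + y) a = ract x a + ract y a ;
  ractDr : forall (x : E) (a b : A), ract x (a + b) = ract x a + ract x b ;
  ractZl : forall (z : R[i]) (x : E) (a : A), ract (z *: x) a = z *: ract x a ;
  ractZr : forall (z : R[i]) (x : E) (a : A), ract x (z *: a) = z *: ract x a ;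
  ractA : forall (x : E) (a b : A), ract x (cmul a b) = ract (ract x a) b ;
  innerDr : forall x y y' : E, inner x (y + y') = inner x y + inner x y' ;
  innerZr : forall (z : R[i]) (x y : E), inner x (z *: y) = z *: inner x y ;
  inner_ract : forall (x y : E) (a : A), inner x (ract y a) = cmul (inner x y) a ;
  inner_star : forall x y : E, cstar (inner x y) = inner y x ;
  inner_pos : forall x : E, cpos (inner x x) ;
  hnormE : forall x : E, `|x| = `|csqrt (inner x x)| }.

#[short(type="hilbertModType")]
HB.structure Definition HilbertModule (R : realType) (A : cstarAlgType R) :=
  {E of isHilbertModule R A E & CompleteNormedModule R[i] E}.

Lemma innerDl (R : realType) (A : cstarAlgType R) (E : hilbertModType A)
  (x x' y : E) : inner (x + x') y = inner x y + inner x' y :> A.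
Proof. by rewrite -[LHS]inner_star innerDr cstarD !inner_star. Qed.

Lemma innerZl (R : realType) (A : cstarAlgType R) (E : hilbertModType A)
  (z : R[i]) (x y : E) : inner (z *: x) y = z^* *: inner x y :> A.
Proof. by rewrite -[LHS]inner_star innerZr cstarZ inner_star. Qed.

Definition linear_subspace (K : pzRingType) (V : lmodType K) (S : set V) :=
  S 0 /\ forall (z : K) (u v : V), S u -> S v -> S (z *: u + v).

Definition closed_span (K : numFieldType) (V : normedModType K) (S : set V) :
  set V := closure (smallest (@linear_subspace K V) S).

Definition bounded_operator (K : numFieldType) (V : normedModType K)
    (T : V -> V) :=
  linear T /\ exists M : K, forall x : V, `|T x| <= M * `|x|.

(* Operator-norm closedness: [`|T x - S x| <= e * `|x|] for all [x] says that
   the operator norm of [T - S] is at most [e]. *)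
Definition norm_closed (K : numFieldType) (V : normedModType K)
    (O : set (V -> V)) :=
  forall T : V -> V, bounded_operator T ->
    (forall e : K, 0 < e ->
       exists2 S, O S & forall x : V, `|T x - S x| <= e * `|x|) ->
    O T.

Definition norm_closed_subalgebra (K : numFieldType) (V : normedModType K)
    (O : set (V -> V)) :=
  [/\ O `<=` @bounded_operator K V, linear_subspace O,
      (forall S T, O S -> O T -> O (S \o T)) & norm_closed O].

Definition lat (K : numFieldType) (V : normedModType K) (O : set (V -> V)) :
    set (set V) :=
  [set M | [/\ linear_subspace M, closed M
             & forall T, O T -> forall m, M m -> M (T m)]].

(* Meet and join of a family [F] in a complete lattice of closed subspaces with
   greatest element [top]; intersecting with [top] only matters for the empty
   family. *)
Definition lat_meet (V : Type) (top : set V) (F : set (set V)) : set V :=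
  top `&` \bigcap_(M in F) M.

Definition lat_join (K : numFieldType) (V : normedModType K)
    (F : set (set V)) : set V :=
  closed_span (\bigcup_(M in F) M).

Definition complete_lattice_iso (K : numFieldType) (V W : normedModType K)
    (topV : set V) (LV : set (set V)) (topW : set W) (LW : set (set W))
    (f : set V -> set W) :=
  [/\ set_bij LV LW f,
      (forall I J, LV I -> LV J -> (I `<=` J <-> f I `<=` f J)),
      (forall F, F `<=` LV -> f (lat_meet topV F) = lat_meet topW (f @` F))
    & (forall F, F `<=` LV -> f (lat_join F) = lat_join (f @` F))].

Section HilbertModuleOperators.
Variables (R : realType) (A : cstarAlgType R) (E : hilbertModType A).

Definition inner_ideal : set A :=
  closed_span [set inner p.1 p.2 | p in [set: E * E]].

Definition End_mod : set (E -> E) :=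
  [set T | bounded_operator T /\
           forall (x : E) (a : A), T (ract x a) = ract (T x) a].

Definition adjointable : set (E -> E) :=
  [set T | linear T /\
           forall y : E, exists y' : E,
             forall x : E, inner (T x) y = inner x y' :> A].

Definition theta (eta xi : E) : E -> E := fun x => ract eta (inner xi x : A).

Definition compact_operators : set (E -> E) :=
  smallest (@norm_closed_subalgebra R[i] E)
    [set theta p.1 p.2 | p in [set: E * E]].

Definition submodule_of (J : set A) : set E :=
  closed_span [set ract p.1 p.2 | p in [set: E] `*` J].

End HilbertModuleOperators.

Arguments inner_ideal {R A} E _.
Arguments End_mod {R A} E _.
Arguments adjointable {R A} E _.
Arguments theta {R A E} eta xi _.
Arguments compact_operators {R A} E _.
Arguments submodule_of {R A} E J _.

(* [B] is intended to be a closed subalgebra of [A]; left ideals are taken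
   relative to [B], not to [A]. *)
Definition closed_left_ideal (R : realType) (A : cstarAlgType R) (B : set A) :
    set (set A) :=
  [set J | [/\ J `<=` B, linear_subspace J, closed J
             & forall b j, B b -> J j -> J (cmul b j)]].

(* Main.v *)
Require Import Defs.
From mathcomp Require Import all_boot all_order all_algebra.
From mathcomp Require Import all_classical all_reals all_analysis.
From mathcomp Require Import ring.

(** Write [B] for the closed span of the inner products, and call a closed
    subspace [M] of [E] theta-invariant when every [theta eta xi] maps it into
    itself.  Everything rests on two approximations,
<<
      x ~ xi <x, x>   for some xi in E       (x in E),
      a ~ c a^* a     for some c in A        (a in A).
>>
    By the first one, all the lattices of invariant subspaces equal the lattice
    of theta-invariant subspaces.  The operators [theta eta xi] belong to each
    of the three algebras, which gives one inclusion.  Conversely, let [M] be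
    theta-invariant and [m] in [M].  If [T] is bounded and [A]-linear, then
    [T m ~ T xi <m, m>], which lies in [M].  If [T] has an adjoint [S], then
    [T m ~ xi <T m, T m> = xi <S (T m), m>], which lies in [M].  The bounded
    operators preserving [M] form a norm-closed algebra, so they include the
    compact operators.

    The inverse of [J |-> E(J)] sends [M] to the ideal [ideal_of M] of those [a]
    in [B] such that [E a] is contained in [M].  For theta-invariant [M] and [m]
    in [M], the element [<m, m>] is in [ideal_of M] and [m ~ xi <m, m>], so
    [M = E(ideal_of M)].  If [a] is in [ideal_of (E(J))], then
    [<y, x> a = <y, x a>] is in [<E, E(J)>], hence in [J], so [B a] is contained
    in [J]; the approximation is [a ~ b a] with [b = c a^* ] in [B], so [a] is
    in [J].  Meets and joins are then compared as in any order isomorphism.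

    Both approximations come from [approx_unit]: for every self-adjoint [k]
    there is [e] in [C k + A k] with [(1 - e)^* k (1 - e)] small.  Applied to
    [k = <x, x>] it bounds the square of the norm of [x - x e], and applied to
    [k = a^* a] that of [a - a e].  In place of the functional calculus, [e] is
    an average of powers: scale [k] to norm at most [1] and put
    [v = 1 - i s k].  As [v v^* = 1 + s^2 k^2], the powers [v^j] with
    [j s^2 <= 1/2] have norm at most [2], and their average [1 - e] over
    [j < m] satisfies
<<
      (i s) k (1 - e) = (1 - v^m) / m,
>>
    so that [k (1 - e)] has norm at most [3 / (s m)].  For [s = 1 / (2 N)] and
    [m = 2 N^2] one has [m s^2 = 1/2], and the bound is [3 / N]. *)

Set Implicit Arguments.
Unset Strict Implicit.
Unset Printing Implicit Defensive.

Import Order.TTheory GRing.Theory Num.Theory.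
Import numFieldNormedType.Exports.
Local Open Scope classical_set_scope.
Local Open Scope ring_scope.

(** * Closed subspaces and semilinear maps *)

Section Subspaces.
Variables (K : numFieldType).
Implicit Types V W : normedModType K.

Lemma closure_normP V (S : set V) x :
  closure S x <-> forall e : K, 0 < e -> exists2 y, S y & `|x - y| < e.
Proof.
split=> [cSx e e0|H U].
  have [y [Sy]] := cSx _ (nbhsx_ballx x e e0).
  by rewrite -ball_normE => ?; exists y.
rewrite -filter_from_norm_nbhs => -[e /= e0 eU].
have [y Sy xy] := H _ e0; exists y; split => //; exact: eU.
Qed.

Lemma subspaceD V (S : set V) u v :
  linear_subspace S -> S u -> S v -> S (u + v).
Proof. by move=> [_ +] Su Sv => /(_ 1 u v Su Sv); rewrite scale1r. Qed.

Lemma subspaceZ V (S : set V) z u : linear_subspace S -> S u -> S (z *: u).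
Proof. by move=> [S0 +] Su => /(_ z u 0 Su S0); rewrite addr0. Qed.

Lemma linear_subspace_closure V (S : set V) :
  linear_subspace S -> linear_subspace (closure S).
Proof.
move=> sS; split=> [|z u v /closure_normP Su /closure_normP Sv].
  by apply: subset_closure; case: sS.
apply/closure_normP => e e0.
have z1 : 0 < `|z| + 1 by rewrite ltr_wpDl.
have e2 : 0 < e / 2 by rewrite divr_gt0.
have [u' Su' uu'] := Su _ (divr_gt0 e2 z1).
have [v' Sv' vv'] := Sv _ e2.
exists (z *: u' + v'); first exact: sS.2.
rewrite opprD addrACA -scalerBr (le_lt_trans (ler_normD _ _))//.
rewrite (splitr e) ler_ltD// normrZ.
rewrite (le_trans (ler_wpM2r _ (_ : _ <= `|z| + 1)))// ?lerDl//.
by rewrite mulrC -ler_pdivlMr// ltW.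
Qed.

Lemma smallest_linear_subspace V (S : set V) :
  linear_subspace (smallest (@linear_subspace K V) S).
Proof.
split=> [M [[]]//|z u v Su Sv M [sM SM]].
by apply: sM.2; [exact: Su|exact: Sv].
Qed.

Lemma linear_subspace_span V (S : set V) : linear_subspace (closed_span S).
Proof. exact/linear_subspace_closure/smallest_linear_subspace. Qed.

Lemma closed_closed_span V (S : set V) : closed (closed_span S).
Proof. exact: closed_closure. Qed.

Lemma sub_closed_span V (S : set V) : S `<=` closed_span S.
Proof.
move=> x Sx; rewrite /closed_span; apply: subset_closure.
exact: sub_gen_smallest.
Qed.

Lemma closure_sub V (S M : set V) : closed M -> S `<=` M -> closure S `<=` M.
Proof. by move=> cM SM; apply: subset_trans cM; exact: closure_subset. Qed.

Lemma closed_span_sub V (S M : set V) :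
  linear_subspace M -> closed M -> S `<=` M -> closed_span S `<=` M.
Proof. by move=> sM cM SM; apply: closure_sub => //; exact: smallest_sub. Qed.

(** Semilinearity with an arbitrary [s] covers at once the linear maps and the
    conjugate-linear ones [cstar] and [inner ^~ y]. *)
Lemma bounded_preim V W (s : K -> K) (f : V -> W) (C : K) (M : set W) :
  {morph f : u v / u - v} -> (forall z u, f (z *: u) = s z *: f u) ->
  (forall u, `|f u| <= C * `|u|) ->
  linear_subspace M -> closed M ->
  linear_subspace (f @^-1` M) /\ closed (f @^-1` M).
Proof.
move=> fB fZ fb sM cM.
have f0 : f 0 = 0 by rewrite -(subrr 0) fB subrr.
have fD u v : f (u + v) = f u + f v.
  by rewrite -[v in LHS]opprK -[- v]sub0r !fB f0 sub0r opprK.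
split; [split=> [|z u v Mu Mv] | move=> x /closure_normP Mx].
- by rewrite /preimage/= f0; case: sM.
- by rewrite /preimage/= fD fZ; apply: sM.2.
apply: cM; apply/closure_normP => e e0.
have C1 : 0 < `|C| + 1 by rewrite ltr_wpDl.
have [y My xy] := Mx _ (divr_gt0 e0 C1).
exists (f y) => //; rewrite -fB.
have [->|xy0] := eqVneq (x - y) 0; first by rewrite f0 normr0.
apply: (@le_lt_trans _ _ (`|C| * `|x - y|)); last first.
  rewrite (@lt_trans _ _ ((`|C| + 1) * `|x - y|))//.
    by rewrite ltr_pM2r ?normr_gt0// ltrDl.
  by rewrite mulrC -ltr_pdivlMr.
rewrite (le_trans (fb _))//.
have C0 : 0 <= C * `|x - y| := le_trans (normr_ge0 _) (fb _).
by rewrite -[leLHS]ger0_norm// normrM normr_id.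
Qed.

Lemma bounded_closed_span V W (s : K -> K) (f : V -> W) (C : K)
    (S : set V) (M : set W) :
  {morph f : u v / u - v} -> (forall z u, f (z *: u) = s z *: f u) ->
  (forall u, `|f u| <= C * `|u|) ->
  linear_subspace M -> closed M ->
  (forall u, S u -> M (f u)) -> forall u, closed_span S u -> M (f u).
Proof.
move=> fB fZ fb sM cM SM; have [sP cP] := bounded_preim fB fZ fb sM cM.
exact: (closed_span_sub sP cP).
Qed.

Lemma lat_sub V (O O' : set (V -> V)) : O `<=` O' -> lat O' `<=` lat O.
Proof. by move=> OO' M [sM cM MO']; split=> // T /OO'; exact: MO'. Qed.

Lemma lat_meet_lat V (O : set (V -> V)) (F : set (set V)) :
  F `<=` lat O -> lat O (lat_meet setT F).
Proof.
move=> FL; split=> [|a cla|T OT m [_ Fm]].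
- split; first by split=> // M /FL[[]].
  move=> z u v [_ Fu] [_ Fv]; split=> // M FM.
  by have [[_ +] _ _] := FL _ FM; apply; [exact: Fu|exact: Fv].
- split=> // M FM; have [_ cM _] := FL _ FM.
  by apply: (closure_sub cM) cla => ? [_]; apply.
- split=> // M FM; have [_ _ +] := FL _ FM; apply => //; exact: Fm.
Qed.

End Subspaces.

(** * Bounded approximate units in a C*-algebra *)

Lemma exists_nat_div_lt (R : realType) (e C : R[i]) : 0 < e -> 0 <= C ->
  exists2 N, (0 < N)%N & C / N%:R < e.
Proof.
move=> e0 C0.
have [n nC] : exists n : nat, C / e < n%:R.
  have : 0 <= C / e by rewrite divr_ge0// ltW.
  case: (C / e) => r i; rewrite lecE/= => /andP[/eqP i0 r0].
  exists (Num.bound r); rewrite i0.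
  by rewrite -(rmorph_nat (real_complex R)) ltcR archi_boundP.
exists n.+1 => //; rewrite ltr_pdivrMr// mulrC -ltr_pdivrMr//.
by rewrite (lt_trans nC)// ltr_nat.
Qed.

Section CStar.
Variables (R : realType) (A : cstarAlgType R).
Implicit Types a b c k w : A.

Lemma cmul0l a : cmul 0 a = 0 :> A.
Proof. by have := cmulZl 0 0 a; rewrite !scale0r. Qed.

Lemma cmul0r a : cmul a 0 = 0 :> A.
Proof. by have := cmulZr 0 a 0; rewrite !scale0r. Qed.

Lemma cmulBl a b c : cmul (a - b) c = cmul a c - cmul b c.
Proof. by rewrite cmulDl -scaleN1r cmulZl scaleN1r. Qed.

Lemma cmulBr a b c : cmul a (b - c) = cmul a b - cmul a c.
Proof. by rewrite cmulDr -scaleN1r cmulZr scaleN1r. Qed.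

Lemma cmul_sumr a n (p : nat -> A) :
  cmul a (\sum_(0 <= j < n) p j) = \sum_(0 <= j < n) cmul a (p j).
Proof. exact: (big_morph _ (cmulDr a) (cmul0r a)). Qed.

Lemma cstarB a b : cstar (a - b) = cstar a - cstar b.
Proof. by rewrite cstarD -scaleN1r cstarZ rmorphN1 scaleN1r. Qed.

Lemma norm_cstar a : `|cstar a| = `|a|.
Proof.
have le b : `|b| <= `|cstar b|.
  have [->|b0] := eqVneq b 0; first by rewrite normr0.
  by rewrite -(ler_pM2r (_ : 0 < `|b|)) ?normr_gt0// -expr2 -cnorm_star cnormM.
by apply/le_anti; rewrite -{2}(cstarK a) !le.
Qed.

Lemma cnorm_mulstar a : `|cmul a (cstar a)| = `|a| ^+ 2.
Proof. by rewrite -{1}(cstarK a) cnorm_star norm_cstar. Qed.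

(** With [v = 1 - i s k] one has [v v^* = 1 + s^2 k^2], as [k] is self-adjoint.
    So right multiplication by [v] enlarges norms by a factor of at most the
    square root of [1 + s^2], where the triangle inequality gives [1 + s]. *)
Lemma norm_sub_imaginary k (s : R[i]) w :
  cstar k = k -> `|k| <= 1 -> 0 <= s ->
  `|w - ('i * s) *: cmul w k| ^+ 2 <= (1 + s ^+ 2) * `|w| ^+ 2.
Proof.
move=> kk k1 s0; rewrite -cnorm_mulstar.
have sc : s^* = s by apply/CrealP; rewrite ger0_real.
have -> : cmul (w - ('i * s) *: cmul w k) (cstar (w - ('i * s) *: cmul w k))
    = cmul w (cstar w) + s ^+ 2 *: cmul (cmul w k) (cstar (cmul w k)).
  rewrite cstarB cstarZ rmorphM/= sc conjCi mulNr scaleNr opprK.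
  rewrite cstarM kk cmulDr !cmulBl !cmulZl !cmulZr !cmulA addrA subrK.
  by rewrite scalerA mulrACA -expr2 sqrCi mulN1r scaleNr opprK.
rewrite (le_trans (ler_normD _ _))// normrZ !cnorm_mulstar mulrDl mul1r lerD2l.
rewrite normrX (ger0_norm s0) ler_wpM2l ?exprn_ge0// ler_sqr ?nnegrE//.
by rewrite (le_trans (cnormM _ _))// ler_piMr.
Qed.

(** [1 - wpoly k s j] is the power [(1 - i s k) ^+ j]; it has to be encoded
    without a unit. *)
Fixpoint wpoly k (s : R[i]) (j : nat) : A :=
  if j is j'.+1 then wpoly k s j' + ('i * s) *: (k - cmul (wpoly k s j') k)
  else 0.

Lemma wpolyS k s w j : w - cmul w (wpoly k s j.+1) =
  (w - cmul w (wpoly k s j)) - ('i * s) *: cmul (w - cmul w (wpoly k s j)) k.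
Proof.
by rewrite /= cmulDr cmulZr cmulBr cmulBl cmulA opprD addrA.
Qed.

Lemma wpolyC k s j : cmul (wpoly k s j) k = cmul k (wpoly k s j).
Proof.
elim: j => [|j IH] /=; first by rewrite cmul0l cmul0r.
by rewrite cmulDl cmulDr cmulZl cmulZr cmulBl cmulBr cmulA IH.
Qed.

Lemma wpoly_telescope k s w j :
  ('i * s) *: (cmul w k - cmul (cmul w k) (wpoly k s j)) =
  (w - cmul w (wpoly k s j)) - (w - cmul w (wpoly k s j.+1)).
Proof. by rewrite wpolyS subKr -cmulA -wpolyC cmulA -cmulBl. Qed.

(** Each factor [1 - i s k] costs at most [1 + s^2] in the square of the norm,
    so [j] of them cost at most [1 / (1 - j s^2)], as in Bernoulli's
    inequality. *)
Lemma norm_wpoly k s w j : cstar k = k -> `|k| <= 1 -> 0 <= s ->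
  j%:R * s ^+ 2 <= 2^-1 -> `|w - cmul w (wpoly k s j)| <= 2 * `|w|.
Proof.
move=> kk k1 s0 js.
have s20 : 0 <= s ^+ 2 by rewrite exprn_ge0.
have Bern n : n%:R * s ^+ 2 <= 2^-1 ->
    (1 + s ^+ 2) ^+ n * (1 - n%:R * s ^+ 2) <= 1.
  elim: n => [|n IH] ns; first by rewrite expr0 mul0r subr0 mulr1.
  apply: le_trans (IH _); last first.
    by apply: le_trans ns; rewrite ler_wpM2r// ler_nat.
  rewrite (exprSr _ n) -mulrA ler_wpM2l ?exprn_ge0 ?addr_ge0//.
  rewrite -subr_ge0.
  have -> : 1 - n%:R * s ^+ 2 - (1 + s ^+ 2) * (1 - n.+1%:R * s ^+ 2)
     = n.+1%:R * s ^+ 2 * s ^+ 2 by rewrite -natr1; ring.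
  by rewrite !mulr_ge0.
have pow n : `|w - cmul w (wpoly k s n)| ^+ 2 <= (1 + s ^+ 2) ^+ n * `|w| ^+ 2.
  elim: n => [|n IH]; first by rewrite expr0 mul1r/= cmul0r subr0.
  rewrite wpolyS (le_trans (norm_sub_imaginary _ _ _ _))// (exprS _ n) -mulrA.
  by rewrite ler_wpM2l// addr_ge0.
rewrite -ler_sqr ?nnegrE ?mulr_ge0// (le_trans (pow _))// exprMn.
rewrite ler_wpM2r ?exprn_ge0//.
have half : 2^-1 <= 1 - j%:R * s ^+ 2.
  by rewrite lerBrDr [leRHS]splitr div1r lerD2l.
rewrite -(@ler_pM2r _ 2^-1) ?invr_gt0//.
apply: (@le_trans _ _ ((1 + s ^+ 2) ^+ j * (1 - j%:R * s ^+ 2))).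
  by rewrite ler_wpM2l// exprn_ge0// addr_ge0.
rewrite (le_trans (Bern _ js))// expr2 mulrK ?unitfE//.
by rewrite ler1n.
Qed.

(** [1 - cesaro k N] is the average of the powers [(1 - i s k) ^+ j] with
    [s = 1 / (2 N)] and [j < 2 N^2]. *)
Definition cesaro k (N : nat) : A :=
  (2 * N ^ 2)%:R^-1 *: \sum_(0 <= j < 2 * N ^ 2) wpoly k (2 * N)%:R^-1 j.

Lemma cesaroE k N w : (0 < N)%N -> w - cmul w (cesaro k N) =
  (2 * N ^ 2)%:R^-1 *:
    \sum_(0 <= j < 2 * N ^ 2) (w - cmul w (wpoly k (2 * N)%:R^-1 j)).
Proof.
move=> N0; rewrite sumrB sumr_const_nat subn0 -(scaler_nat _ w).
rewrite scalerBr scalerA mulVf ?scale1r; last first.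
  by rewrite pnatr_eq0 -lt0n muln_gt0 expn_gt0 N0.
by rewrite /cesaro -cmul_sumr -cmulZr.
Qed.

Lemma norm_wpoly_le k N w j : cstar k = k -> `|k| <= 1 -> (0 < N)%N ->
  (j <= 2 * N ^ 2)%N ->
  `|w - cmul w (wpoly k (2 * N)%:R^-1 j)| <= 2 * `|w|.
Proof.
move=> kk k1 N0 jN; apply: norm_wpoly => //.
rewrite exprVn -natrX ler_pdivrMr ?ltr0n ?expn_gt0 ?muln_gt0 ?N0//.
rewrite (_ : _ * _ = (2 * N ^ 2)%:R) ?ler_nat//.
by rewrite !(natrM, natrX); field.
Qed.

Lemma norm_cesaro k N w : cstar k = k -> `|k| <= 1 -> (0 < N)%N ->
  `|w - cmul w (cesaro k N)| <= 2 * `|w|.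
Proof.
move=> kk k1 N0; rewrite cesaroE// normrZ ger0_norm ?invr_ge0//.
have m0 : 0 < (2 * N ^ 2)%:R :> R[i] by rewrite ltr0n muln_gt0 expn_gt0 N0.
rewrite mulrC ler_pdivrMr// (le_trans (ler_norm_sum _ _ _))//.
rewrite (@le_trans _ _ (\sum_(0 <= j < 2 * N ^ 2) (2 * `|w|)))//.
  by apply: ler_sum_nat => j /andP[_ /ltnW]; exact: norm_wpoly_le.
by rewrite sumr_const_nat subn0 [leRHS]mulr_natr.
Qed.

(** The average of the [v ^+ j], for [v = 1 - i s k], telescopes against
    [i s k = 1 - v], and both ends of the telescope are bounded by
    [norm_wpoly_le]. *)
Lemma norm_mul_cesaro k N w : cstar k = k -> `|k| <= 1 -> (0 < N)%N ->
  `|cmul w k - cmul (cmul w k) (cesaro k N)| <= 3 / N%:R * `|w|.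
Proof.
move=> kk k1 N0.
have N0' : N%:R != 0 :> R[i] by rewrite pnatr_eq0 -lt0n.
rewrite cesaroE// normrZ ger0_norm ?invr_ge0//.
have -> : \sum_(0 <= j < 2 * N ^ 2)
    (cmul w k - cmul (cmul w k) (wpoly k (2 * N)%:R^-1 j)) =
    ('i * (2 * N)%:R^-1)^-1 *:
      (w - (w - cmul w (wpoly k (2 * N)%:R^-1 (2 * N ^ 2)))).
  have i0 : 'i * (2 * N)%:R^-1 != 0 :> R[i].
    by rewrite mulf_neq0 ?neq0Ci// invr_eq0 natrM mulf_neq0.
  apply: (scalerI i0); rewrite scalerA divff// scale1r scaler_sumr.
  under eq_bigr do rewrite wpoly_telescope -opprB.
  by rewrite sumrN telescope_sumr// opprB/= cmul0r subr0.
rewrite normrZ invfM invrK normrM normfV normCi invr1 mul1r ger0_norm//.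
apply: (@le_trans _ _ ((2 * N ^ 2)%:R^-1 * ((2 * N)%:R * (3 * `|w|)))).
  rewrite ler_wpM2l ?invr_ge0// ler_wpM2l// (le_trans (ler_normB _ _))//.
  rewrite (_ : 3 * _ = `|w| + 2 * `|w|); last by ring.
  by rewrite lerD2l norm_wpoly_le.
by rewrite le_eqVlt; apply/orP; left; apply/eqP; rewrite !(natrM, natrX); field.
Qed.

(** The left ideal generated by [k] in the unitization of [A]. *)
Definition principal k : set A :=
  [set e | exists z a, e = z *: k + cmul a k].

Lemma principal_subspace k : linear_subspace (principal k).
Proof.
split=> [|z u v [x [a ->]] [y [b ->]]].
  by exists 0, 0; rewrite scale0r cmul0l addr0.
exists (z * x + y), (z *: a + b).
by rewrite cmulDl cmulZl scalerDr scalerDl scalerA addrACA.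
Qed.

Lemma principal_cesaro k N : principal k (cesaro k N).
Proof.
have sP := principal_subspace k.
have Pw s j : principal k (wpoly k s j).
  elim: j => [|j IH]; first by case: sP.
  apply: (subspaceD sP) => //; apply: (subspaceZ _ sP).
  exists 1, (- wpoly k s j).
  by rewrite scale1r -[in RHS]sub0r cmulBl cmul0l sub0r.
apply: (subspaceZ _ sP); elim/big_ind: _ => //; first by case: sP.
by move=> *; exact: subspaceD.
Qed.

(** For [e = cesaro k N], [norm_mul_cesaro] makes [k k (1 - e)] small.  Then
    [(k (1 - e))^* (k (1 - e)) = (1 - e)^* k k (1 - e)] is small, because
    multiplication by [1 - e] at most doubles norms.  So [k (1 - e)] is small,
    and [(1 - e)^* k (1 - e)] with it. *)
Lemma approx_unit k (eps : R[i]) : cstar k = k -> 0 < eps ->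
  exists2 e, principal k e &
  `|k - cmul k e - cmul (cstar e) k + cmul (cstar e) (cmul k e)| < eps.
Proof.
wlog k1 : k eps / `|k| <= 1 => [hw|] kk eps0.
  have [|k1] := boolP (`|k| <= 1); first by move=> k1; exact: hw.
  have k0 : k != 0 by apply: contraNneq k1 => ->; rewrite normr0.
  have k0' : 0 < `|k| by rewrite normr_gt0.
  have [|||e [z [a ea]] ke] := hw (`|k|^-1 *: k) (eps / `|k|).
  - by rewrite normrZ normfV normr_id mulVf ?gt_eqF.
  - rewrite cstarZ kk; congr (_ *: _).
    by apply/CrealP; rewrite ger0_real// invr_ge0.
  - by rewrite divr_gt0.
  exists e.
    exists (z * `|k|^-1), (`|k|^-1 *: a).
    by rewrite ea scalerA cmulZl cmulZr.
  move: ke; rewrite ltr_pdivlMr//.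
  by rewrite !(cmulZl,cmulZr) -!scalerBr -scalerDr normrZ normfV normr_id
    mulrC mulrA divff ?gt_eqF// mul1r.
(* The bounds 2 on [1 - e] and 6 / N on the square of the norm of [k (1 - e)]
   make 24 / N out of the square of the final norm. *)
have [N N0 Ne] := exists_nat_div_lt (exprn_gt0 2 eps0) (ler0n _ 24).
exists (cesaro k N); first exact: principal_cesaro.
set e := cesaro k N.
have G w : `|w - cmul w e| <= 2 * `|w| by exact: norm_cesaro.
have ske : cstar (k - cmul k e) = k - cmul (cstar e) k.
  by rewrite cstarB cstarM kk.
have Gkk : `|k - cmul k e| ^+ 2 <= 6 / N%:R.
  rewrite -cnorm_star ske.
  rewrite (_ : cmul _ _ = cmul (k - cmul (cstar e) k) k
      - cmul (cmul (k - cmul (cstar e) k) k) e); last by rewrite cmulBr cmulA.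
  rewrite (le_trans (G _))// -norm_cstar cstarM kk -ske cstarK cmulBr cmulA.
  rewrite (le_trans (ler_wpM2l _ (norm_mul_cesaro _ _ _ _)))//.
  rewrite mulrA (_ : 2 * (3 / N%:R) = 6 / N%:R); last by ring.
  by rewrite ler_piMr// divr_ge0.
rewrite -ltr_sqr ?nnegrE// ?ltW//.
apply: le_lt_trans Ne.
have -> : k - cmul k e - cmul (cstar e) k + cmul (cstar e) (cmul k e) =
    (k - cmul (cstar e) k) - cmul (k - cmul (cstar e) k) e.
  by rewrite cmulBl cmulA opprB addrA [RHS]addrAC [k - _ - _]addrAC.
rewrite (@le_trans _ _ ((2 * `|k - cmul k e|) ^+ 2))//.
  rewrite ler_sqr ?nnegrE ?mulr_ge0// (le_trans (G _))//.
  by rewrite -ske norm_cstar.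
rewrite exprMn (_ : 24 / _ = 2 ^+ 2 * (6 / N%:R)); last by ring.
by rewrite ler_wpM2l// exprn_ge0.
Qed.

(** The factor [c (cstar a)] lies in every left ideal of [A] that contains
    [cstar a]; this is what makes [a] a limit of elements of [B a] for [a] in
    the self-adjoint ideal [B]. *)
Lemma approx_regular a (eps : R[i]) : 0 < eps ->
  exists c, `|a - cmul (cmul c (cstar a)) a| < eps.
Proof.
move=> eps0.
have kk : cstar (cmul (cstar a) a) = cmul (cstar a) a by rewrite cstarM cstarK.
have [e [z [b ee]] ke] := approx_unit kk (exprn_gt0 2 eps0).
exists (z *: a + cmul a b).
have -> : cmul (cmul (z *: a + cmul a b) (cstar a)) a = cmul a e.
  by rewrite ee cmulDr cmulZr !cmulDl !cmulZl !cmulA.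
rewrite -ltr_sqr ?nnegrE// ?ltW// -cnorm_star.
move: ke; congr (`|_| < _).
rewrite cstarB cstarM cmulBr !cmulBl !cmulA opprB addrA [RHS]addrAC.
by congr (_ + _); rewrite addrAC.
Qed.

End CStar.

(** * Norm estimates and approximation in a Hilbert module *)

Section HilbertModule.
Variables (R : realType) (A : cstarAlgType R) (E : hilbertModType A).
Implicit Types (x y xi eta m : E) (a b : A).

Lemma inner0l x : inner 0 x = 0 :> A.
Proof. by have := innerZl 0 0 x; rewrite conjC0 !scale0r. Qed.

Lemma inner0r x : inner x 0 = 0 :> A.
Proof. by have := innerZr 0 x 0; rewrite !scale0r. Qed.

Lemma innerBr x y y' : inner x (y - y') = inner x y - inner x y' :> A.
Proof. by rewrite innerDr -scaleN1r innerZr scaleN1r. Qed.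

Lemma innerBl x x' y : inner (x - x') y = inner x y - inner x' y :> A.
Proof. by rewrite innerDl -scaleN1r innerZl rmorphN1 scaleN1r. Qed.

Lemma ractBr x a b : ract x (a - b) = ract x a - ract x b.
Proof. by rewrite ractDr -scaleN1r ractZr scaleN1r. Qed.

(** If [inner x x] had no positive square root then [csqrt] would return its
    default value [0], so that [x = 0]; but [inner 0 0] has the square root [0].
    Hence the norm formula provides the square root by itself. *)
Lemma norm_inner x : `|inner x x : A| = `|x| ^+ 2.
Proof.
rewrite hnormE /csqrt; case: xgetP => [b bE [[c bc] bb]|nsq].
  rewrite -cnorm_star -bb; congr (`|cmul _ b|).
  by rewrite bc cstarM cstarK.
have x0 : x = 0.
  apply/eqP; rewrite -normr_eq0 hnormE /csqrt.
  by case: xgetP => [b bE /nsq//|_]; rewrite normr0.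
by rewrite x0 inner0l normr0 expr0n.
Qed.

Lemma norm_ract x a : `|ract x a| <= `|x| * `|a|.
Proof.
rewrite -ler_sqr ?nnegrE ?mulr_ge0// -norm_inner inner_ract -inner_star.
rewrite inner_ract cstarM inner_star (le_trans (cnormM _ _))//.
rewrite (le_trans (ler_wpM2r _ (cnormM _ _)))// norm_cstar norm_inner.
by rewrite (_ : _ * _ * _ = (`|x| * `|a|) ^+ 2)//; ring.
Qed.

(** Polarization writes the inner product in terms of the [inner u u], whose
    norms are known; it avoids the order of [A], at the price of the constant
    [8] in place of [1]. *)
Lemma norm_inner_le x y : `|inner x y : A| <= 8 * `|x| * `|y|.
Proof.
have pol (u v : E) : `|inner u v : A| <= 2 * (`|u| + `|v|) ^+ 2.
  have pol1 z : `|z| = 1 ->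
      `|z *: (inner u v : A) + z^* *: inner v u| <= 2 * (`|u| + `|v|) ^+ 2.
    move=> z1.
    have -> : z *: (inner u v : A) + z^* *: inner v u =
        inner (u + z *: v) (u + z *: v) - (inner u u + inner v v).
      rewrite !(innerDl, innerDr, innerZl, innerZr) scalerA.
      rewrite [_^* * z]mulrC -normCK z1 expr1n.
      by rewrite scale1r [z^* *: _ + _]addrC addrACA [RHS]addrC addKr.
    rewrite (le_trans (ler_normB _ _))// mulr_natl lerD//.
      rewrite norm_inner ler_sqr ?nnegrE ?addr_ge0//.
      by rewrite (le_trans (ler_normD _ _))// normrZ z1 mul1r.
    rewrite (le_trans (ler_normD _ _))// !norm_inner sqrrD -addrA lerD2l.
    by rewrite addrC lerDl mulrn_wge0// mulr_ge0.
  rewrite -(@ler_pM2l _ 2)// -[X in X * `|_|]ger0_norm// -normrZ.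
  have -> : 2 *: (inner u v : A) = (1 *: inner u v + 1^* *: inner v u)
      - 'i *: ('i *: inner u v + 'i^* *: inner v u).
    rewrite scalerDr !scalerA conjCi mulrN -expr2 sqrCi opprK scaleN1r.
    rewrite opprD opprK conjC1 !scale1r addrACA subrr addr0.
    by rewrite scaler_nat mulr2n.
  rewrite (le_trans (ler_normB _ _))// [leRHS]mulr_natl lerD// ?pol1 ?normr1//.
  by rewrite normrZ normCi mul1r pol1// normCi.
have [->|x0] := eqVneq x 0; first by rewrite inner0l !normr0 mulr0 mul0r.
have [->|y0] := eqVneq y 0; first by rewrite inner0r !normr0 mulr0.
have x0' : 0 < `|x| by rewrite normr_gt0.
have y0' : 0 < `|y| by rewrite normr_gt0.
have := pol (`|x|^-1 *: x) (`|y|^-1 *: y).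
rewrite innerZl innerZr !normrZ norm_conjC !normfV !normr_id.
rewrite !mulVf ?gt_eqF// mulrA -invfM mulrC ler_pdivrMr ?mulr_gt0//.
by rewrite (_ : 2 * _ * _ = 8 * `|x| * `|y|)//; ring.
Qed.

(** The special form [z *: k + cmul a k] of [e] for [k = inner x x] turns [x e]
    into [ract xi (inner x x)]. *)
Lemma approx_ract x (eps : R[i]) : 0 < eps ->
  exists xi, `|x - ract xi (inner x x : A)| < eps.
Proof.
move=> eps0.
have [e [z [b ee]] ke] := approx_unit (inner_star x x : _ = _ :> A)
  (exprn_gt0 2 eps0).
exists (z *: x + ract x b).
have -> : ract (z *: x + ract x b) (inner x x : A) = ract x e.
  by rewrite ee ractDr ractZr ractDl ractZl ractA.
rewrite -ltr_sqr ?nnegrE// ?ltW// -norm_inner.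
move: ke; congr (`|_| < _).
have re : inner (ract x e) x = cmul (cstar e) (inner x x) :> A.
  by rewrite -inner_star inner_ract cstarM inner_star.
rewrite innerBr !innerBl !inner_ract re opprB addrA [RHS]addrAC -cmulA.
by congr (_ + _); rewrite addrAC.
Qed.

Lemma norm_theta eta xi x : `|theta eta xi x| <= 8 * `|eta| * `|xi| * `|x|.
Proof.
rewrite (le_trans (norm_ract _ _))//.
rewrite (le_trans (ler_wpM2l _ (norm_inner_le _ _)))//.
by rewrite [leLHS](_ : _ = 8 * `|eta| * `|xi| * `|x|)//; ring.
Qed.

Lemma thetaB eta xi : {morph theta eta xi : x y / x - y}.
Proof. by move=> x y; rewrite /theta innerBr ractBr. Qed.

Lemma thetaZ eta xi z x : theta eta xi (z *: x) = z *: theta eta xi x.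
Proof. by rewrite /theta innerZr ractZr. Qed.

Lemma theta_linear eta xi : linear (theta eta xi).
Proof. by move=> z x y; rewrite /theta innerDr innerZr ractDr ractZr. Qed.

Lemma theta_End_mod eta xi : End_mod E (theta eta xi).
Proof.
split=> [|x a]; last by rewrite /theta inner_ract ractA.
split; first exact: theta_linear.
by eexists => x; exact: norm_theta.
Qed.

Lemma theta_adjointable eta xi : adjointable E (theta eta xi).
Proof.
split=> [|y]; first exact: theta_linear.
exists (theta xi eta y) => x.
by rewrite /theta inner_ract -inner_star inner_ract cstarM !inner_star.
Qed.

(** * Invariant subspaces of the rank-one operators *)

Definition thetas : set (E -> E) := [set theta p.1 p.2 | p in [set: E * E]].

Lemma sub_thetas (O : set (E -> E)) :
  (forall eta xi, O (theta eta xi)) -> thetas `<=` O.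
Proof. by move=> Oth _ [[eta xi] _ <-]. Qed.

Lemma lat_theta M eta xi m : lat thetas M -> M m -> M (theta eta xi m).
Proof. by move=> [_ _]; apply; exists (eta, xi). Qed.

(** The vector to approximate is [T m]: the approximant is a multiple of
    [inner (T m) (T m)], where the adjoint of [T] can be moved to the other
    argument, leaving [m] alone. *)
Lemma lat_adjointable : lat (adjointable E) = lat thetas.
Proof.
apply/seteqP; split.
  by apply/lat_sub; apply: sub_thetas => eta xi; exact: theta_adjointable.
move=> M latM; have [sM cM _] := latM; split=> // T [_ T_adj] m Mm.
apply: cM; apply/closure_normP => e e0.
have [xi Txi] := approx_ract (T m) e0.
exists (ract xi (inner (T m) (T m) : A)) => //.
have [y' Ty'] := T_adj (T m).
by rewrite -inner_star Ty' inner_star; exact: lat_theta.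
Qed.

Lemma lat_End_mod : lat (End_mod E) = lat thetas.
Proof.
apply/seteqP; split.
  by apply/lat_sub; apply: sub_thetas => eta xi; exact: theta_End_mod.
move=> M latM; have [sM cM _] := latM; split=> // T [[Tl [C Tb]] Ta] m Mm.
have TB : {morph T : u v / u - v}.
  move=> u v; have := Tl (-1) v u; rewrite !scaleN1r => Tvu.
  by rewrite addrC Tvu addrC.
have T0 : T 0 = 0 by have := TB 0 0; rewrite !subrr.
have TZ z u : T (z *: u) = z *: T u.
  by have := Tl z u 0; rewrite !addr0 T0 addr0.
have [_ cTM] := bounded_preim (s := id) TB TZ Tb sM cM.
apply: cTM; apply/closure_normP => e e0.
have [xi mxi] := approx_ract m e0.
exists (ract xi (inner m m : A)) => //.
by rewrite /preimage/= Ta; exact: (lat_theta (T xi) m latM Mm).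
Qed.

(** The bounded operators preserving [M] form a norm-closed algebra containing
    the [theta eta xi], hence the algebra that these generate. *)
Lemma lat_compact : lat (compact_operators E) = lat thetas.
Proof.
apply/seteqP; split; first by apply: lat_sub; exact: sub_gen_smallest.
move=> M latM; have [sM cM _] := latM; split=> // T KT m Mm.
pose O := [set T : E -> E | bounded_operator T /\ forall m, M m -> M (T m)].
suff [_] : O T by apply.
apply: KT; split; last first.
  apply: sub_thetas => eta xi; split; last by move=> ?; exact: lat_theta.
  exact: (theta_End_mod _ _).1.
split.
- by move=> S [].
- split=> [|z S S' [[Sl [C Sb]] SM] [[S'l [C' S'b]] S'M]].
    split=> [|? _]; last by case: sM.
    split=> [z u v|]; first by rewrite /= scaler0 addr0.
    by exists 0 => x; rewrite normr0 mul0r.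
  split=> [|u Mu]; last by apply: sM.2; [exact: SM|exact: S'M].
  split=> [c u v|].
    rewrite /= !fctE /= Sl S'l !scalerDr !scalerA mulrC -!addrA.
    by congr (_ + _); rewrite addrCA.
  exists (`|z| * C + C') => x; rewrite (le_trans (ler_normD _ _))//.
  by rewrite mulrDl lerD// normrZ -mulrA ler_wpM2l.
- move=> S S' [[Sl [C Sb]] SM] [[S'l [C' S'b]] S'M].
  split=> [|u Mu]; last exact/SM/S'M.
  split=> [c u v|]; first by rewrite /= S'l Sl.
  exists (`|C| * C') => x; rewrite (le_trans (Sb _))//.
  rewrite (@le_trans _ _ (`|C| * `|S' x|))//; last first.
    by rewrite -mulrA ler_wpM2l.
  have C0 : 0 <= C * `|S' x| := le_trans (normr_ge0 _) (Sb _).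
  by rewrite -[leLHS]ger0_norm// normrM normr_id.
- move=> S bS SO; split=> // u Mu.
  apply: cM; apply/closure_normP => e e0.
  have u1 : 0 < `|u| + 1 by rewrite ltr_wpDl.
  have [S' [_ S'M] SS'] := SO _ (divr_gt0 e0 u1).
  exists (S' u); first exact: S'M.
  rewrite (le_lt_trans (SS' _))// mulrAC ltr_pdivrMr// ltr_pM2l//.
  by rewrite ltrDl.
Qed.

(** * Left ideals and invariant subspaces *)

Lemma inner_idealP x y : inner_ideal E (inner x y).
Proof. by apply: sub_closed_span; exists (x, y). Qed.

Lemma inner_ideal_star b : inner_ideal E b -> inner_ideal E (cstar b).
Proof.
apply: (bounded_closed_span (s := Num.conj) (C := 1)).
- exact: cstarB.
- exact: cstarZ.
- by move=> u; rewrite norm_cstar mul1r.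
- exact: linear_subspace_span.
- exact: closed_closed_span.
- by move=> _ [[x y] _ <-]; rewrite inner_star; exact: inner_idealP.
Qed.

Lemma inner_ideal_mull a b : inner_ideal E b -> inner_ideal E (cmul a b).
Proof.
apply: (bounded_closed_span (s := id) (C := `|a|)).
- exact: cmulBr.
- by move=> z u; exact: cmulZr.
- exact: cnormM.
- exact: linear_subspace_span.
- exact: closed_closed_span.
move=> _ [[x y] _ <-] /=.
have -> : cmul a (inner x y) = inner (ract x (cstar a)) y.
  by rewrite -[RHS]inner_star inner_ract cstarM cstarK inner_star.
exact: inner_idealP.
Qed.

Local Notation B := (inner_ideal E).

Lemma closed_left_ideal_inner : closed_left_ideal B B.
Proof.
split=> //; [exact: linear_subspace_span|exact: closed_closed_span|].
by move=> b j _; exact: inner_ideal_mull.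
Qed.

Lemma submodule_ofP (J : set A) x a : J a -> submodule_of E J (ract x a).
Proof. by move=> Ja; apply: sub_closed_span; exists (x, a). Qed.

Lemma submodule_of_sub (J : set A) (M : set E) :
  linear_subspace M -> closed M -> (forall x a, J a -> M (ract x a)) ->
  submodule_of E J `<=` M.
Proof.
move=> sM cM JM; apply: closed_span_sub => // _ [[x a] [_ Ja] <-].
exact: JM.
Qed.

Lemma submodule_ofS (I J : set A) :
  I `<=` J -> submodule_of E I `<=` submodule_of E J.
Proof.
move=> IJ; apply: submodule_of_sub; [exact: linear_subspace_span| |].
  exact: closed_closed_span.
by move=> x a /IJ; exact: submodule_ofP.
Qed.

Lemma lat_submodule_of (J : set A) :
  closed_left_ideal B J -> lat thetas (submodule_of E J).
Proof.
move=> [_ _ _ lJ].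
have sEJ : linear_subspace (submodule_of E J) by exact: linear_subspace_span.
have cEJ : closed (submodule_of E J) by exact: closed_closed_span.
split=> // _ [[eta xi] _ <-].
apply: (bounded_closed_span (s := id) (@thetaB eta xi) (@thetaZ eta xi)
  (@norm_theta eta xi)) => // _ [[x a] [_ Ja] <-] /=.
rewrite /theta inner_ract; apply: submodule_ofP; apply: lJ => //.
exact: inner_idealP.
Qed.

(** The inverse of [submodule_of E].  For [M] in [lat thetas] it is also the
    closed span of the [inner x m] with [m] in [M], but in this form it is
    visibly a closed left ideal. *)
Definition ideal_of (M : set E) : set A :=
  [set a | B a /\ forall x, M (ract x a)].

Lemma closed_left_ideal_of (M : set E) :
  lat thetas M -> closed_left_ideal B (ideal_of M).
Proof.
move=> [sM cM _]; have [_ [B0 BD] cB _] := closed_left_ideal_inner.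
have pre x : linear_subspace (ract x @^-1` M) /\ closed (ract x @^-1` M).
  apply: (bounded_preim (s := id) (C := `|x|)) => //.
  - exact: ractBr.
  - by move=> z a; exact: ractZr.
  - exact: norm_ract.
split=> [a []//||a cla|b a _ [Ba EaM]].
- split; first by split=> // x; case: (pre x) => -[].
  move=> z a b [Ba EaM] [Bb EbM]; split; first exact: BD.
  by move=> x; have [[_ +] _] := pre x; apply; [exact: EaM|exact: EbM].
- split; first by apply: (closure_sub cB) cla => ? [].
  move=> x; have [_ cx] := pre x.
  by apply: (closure_sub cx) cla => b [_ EbM]; exact: EbM.
- split; first exact: inner_ideal_mull.
  by move=> x; rewrite ractA; exact: EaM.
Qed.

Lemma submodule_of_ideal_of (M : set E) :
  lat thetas M -> submodule_of E (ideal_of M) = M.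
Proof.
move=> latM; have [sM cM _] := latM; apply/seteqP; split.
  by apply: submodule_of_sub => // x a [_]; apply.
move=> m Mm; apply: closed_closed_span; apply/closure_normP => e e0.
have [xi mxi] := approx_ract m e0.
exists (ract xi (inner m m : A)) => //; apply: submodule_ofP.
split; first exact: inner_idealP.
by move=> x; exact: lat_theta.
Qed.

(** [a] multiplies [E] into [submodule_of E J], so [cmul b a] is in [J] for
    every [b] in [B], and [a] is a limit of such products. *)
Lemma ideal_of_submodule_of (J : set A) :
  closed_left_ideal B J -> ideal_of (submodule_of E J) `<=` J.
Proof.
move=> [JB sJ cJ lJ] a [Ba EaEJ].
have EEJ y m : submodule_of E J m -> J (inner y m : A).
  apply: (bounded_closed_span (s := id) (f := inner y) (C := 8 * `|y|)) => //.
  - exact: innerBr.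
  - by move=> z u; exact: innerZr.
  - exact: norm_inner_le.
  - move=> _ [[x j] [_ Jj] <-] /=; rewrite inner_ract.
    by apply: lJ => //; exact: inner_idealP.
have BaJ b : B b -> J (cmul b a).
  apply: (bounded_closed_span (s := id) (f := fun c => cmul c a)
    (C := `|a|)) => //.
  - by move=> u v; exact: cmulBl.
  - by move=> z u; exact: cmulZl.
  - by move=> u; rewrite mulrC; exact: cnormM.
  - by move=> _ [[x y] _ <-] /=; rewrite -inner_ract; exact/EEJ/EaEJ.
apply: cJ; apply/closure_normP => e e0.
have [c ac] := approx_regular a e0.
exists (cmul (cmul c (cstar a)) a) => //.
exact/BaJ/inner_ideal_mull/inner_ideal_star.
Qed.

Lemma submodule_of_le (I J : set A) :
  closed_left_ideal B I -> closed_left_ideal B J ->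
  submodule_of E I `<=` submodule_of E J -> I `<=` J.
Proof.
move=> [IB _ _ _] lJ EIJ a Ia; apply: ideal_of_submodule_of => //.
by split=> [|x]; [exact: IB|exact/EIJ/submodule_ofP].
Qed.

Lemma submodule_of_iso :
  complete_lattice_iso B (closed_left_ideal B) [set: E] (lat thetas)
    (submodule_of E).
Proof.
split.
- split; first by move=> J; exact: lat_submodule_of.
    move=> I J; rewrite !inE => lI lJ EIJ; apply/seteqP; split;
      by apply: submodule_of_le => //; rewrite EIJ.
  move=> M latM; exists (ideal_of M); first exact: closed_left_ideal_of.
  exact: submodule_of_ideal_of.
- move=> I J lI lJ; split; [exact: submodule_ofS|exact: submodule_of_le].
- move=> F FL; apply/seteqP; split.
    move=> x EFx; split=> // _ [J FJ <-].
    by apply: submodule_ofS EFx => a [_]; apply.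
  (* The meet of the images is itself some [E(I)], and [I] lies below each
     member of [F] since the correspondence reflects inclusion. *)
  have latF : lat thetas (lat_meet setT (submodule_of E @` F)).
    by apply: lat_meet_lat => _ [J /FL lJ <-]; exact: lat_submodule_of.
  have lI := closed_left_ideal_of latF.
  rewrite -(submodule_of_ideal_of latF).
  apply: submodule_ofS => a Ia; split; first by have [+ _ _ _] := lI; apply.
  move=> J FJ; apply: (submodule_of_le lI (FL _ FJ)) Ia.
  by rewrite submodule_of_ideal_of// => x [_]; apply; exists J.
- move=> F FL; apply/seteqP; split.
    have sE : linear_subspace (lat_join (submodule_of E @` F)).
      exact: linear_subspace_span.
    have cE : closed (lat_join (submodule_of E @` F)).
      exact: closed_closed_span.
    apply: submodule_of_sub => // x a.
    apply: (bounded_closed_span (s := id) (C := `|x|)) => //.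
    + exact: ractBr.
    + by move=> z b; exact: ractZr.
    + exact: norm_ract.
    move=> b [J FJ Jb]; apply: sub_closed_span; exists (submodule_of E J).
      by exists J.
    exact: submodule_ofP.
  apply: closed_span_sub; [exact: linear_subspace_span| |].
    exact: closed_closed_span.
  move=> x [_ [J FJ <-]]; apply: submodule_ofS => a Ja.
  by apply: sub_closed_span; exists J.
Qed.

End HilbertModule.

Theorem theorem2p3 (R : realType) (A : cstarAlgType R) (E : hilbertModType A) :
  [/\ lat (adjointable E)
        = [set submodule_of E J | J in closed_left_ideal (inner_ideal E)],
      complete_lattice_iso (inner_ideal E) (closed_left_ideal (inner_ideal E))
        [set: E] (lat (adjointable E)) (submodule_of E),
      lat (compact_operators E) = lat (adjointable E)
    & lat (adjointable E) = lat (End_mod E)].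
Proof.
rewrite lat_compact lat_adjointable lat_End_mod; split=> //.
  apply/seteqP; split=> [M latM|_ [J lJ <-]]; last exact: lat_submodule_of.
  exists (ideal_of M); first exact: closed_left_ideal_of.
  exact: submodule_of_ideal_of.
exact: submodule_of_iso.
Qed.
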